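(* Let $n \in \mathbb{N}$, let $\mathcal{F}$ be a family of subsets of $[n]$ with $|\mathcal{F}| = n$ that satisfies the marriage condition, and let $t$ be a transversal of $\mathcal{F}$. Let $S \subseteq [n]$ be the set of elements $k\in[n]$ such that $k \in F$ for exactly one member $F$ of $\mathcal{F}$, and let $m$ be an integer with $\min(n, n-|S|+1) \le m \le n$. Then $\mathcal{F}$ is shellable if and only if for every configuration $f$ of $t$ there exists a surjective map $\sigma:[n]\to[m]$ that satisfies $f$.
   Context: $\mathbb{N}$ denotes the positive integers and $[n]=\{1,\dots,n\}$. Families of sets are treated as multisets (members counted with multiplicity). A family $\mathcal{F}$ of subsets of $[n]$ satisfies the marriage condition if for every subfamily $\mathcal{F}'\subseteq\mathcal{F}$, $|\mathcal{F}'| \le \left|\bigcup_{F\in\mathcal{F}'}F\right|$. A transversal of $\mathcal{F}$ is an injective map $t:\mathcal{F}\to[n]$ (assigning to each member, counted with multiplicity, an element) with $t(F)\in F$ for all $F\in\mathcal{F}$. A configuration of $t$ is a function $f:[n]\to\mathbb{N}$ such that $f(t(F)) \le |F|$ for all $F\in\mathcal{F}$. For $m\le n$, a surjective map $\sigma:[n]\to[m]$ satisfies $f$ if for every $F\in\mathcal{F}$, $\sigma(t(F))$ is the $k$-th smallest element of the set $\sigma(F)=\{\sigma(i): i\in F\}$, where $k=f(t(F))$. $\mathcal{F}$ (with $|\mathcal{F}|=m'$) is shellable if there is an ordering $F_1,\dots,F_{m'}$ of its members such that $\left|\bigcup_{i=1}^k F_i\right| = k$ for every $k\in[m']$. *)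

(* Defs.v *)
From mathcomp Require Import all_boot all_fingroup.

Set Implicit Arguments.
Unset Strict Implicit.
Unset Printing Implicit Defensive.

(* The ground set [n] is 'I_n, shifted to start at 0.  A family (multiset) of
   p subsets of [n] is an indexed family F : 'I_p -> {set 'I_n}: distinct
   indices may carry the same set, and subfamilies are sets of indices. *)

Definition marriage_condition (n p : nat) (F : 'I_p -> {set 'I_n}) : Prop :=
  forall J : {set 'I_p}, #|J| <= #|\bigcup_(i in J) F i|.

Definition family_transversal (n p : nat) (F : 'I_p -> {set 'I_n})
    (t : 'I_p -> 'I_n) : Prop :=
  injective t /\ forall i, t i \in F i.

(* The values of f are positive integers: f gives 1-based ranks. *)
Definition configuration (n p : nat) (F : 'I_p -> {set 'I_n})
    (t : 'I_p -> 'I_n) (f : 'I_n -> nat) : Prop :=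
  (forall x, 0 < f x) /\ forall i, f (t i) <= #|F i|.

(* Here k is 1-based; no x qualifies when k = 0 or k > #|A|. *)
Definition kth_smallest (m : nat) (A : {set 'I_m}) (k : nat) (x : 'I_m) : Prop :=
  x \in A /\ #|[set y in A | y < x]|.+1 = k.

Definition surjective (A B : Type) (g : A -> B) : Prop :=
  forall b, exists a, g a = b.

Definition satisfies (n p m : nat) (F : 'I_p -> {set 'I_n})
    (t : 'I_p -> 'I_n) (f : 'I_n -> nat) (sigma : 'I_n -> 'I_m) : Prop :=
  forall i, kth_smallest [set sigma x | x in F i] (f (t i)) (sigma (t i)).

Definition shellable (n p : nat) (F : 'I_p -> {set 'I_n}) : Prop :=
  exists s : {perm 'I_p}, forall k, 0 < k <= p ->
    #|\bigcup_(i < p | i < k) F (s i)| = k.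

Definition in_exactly_one (n p : nat) (F : 'I_p -> {set 'I_n}) : {set 'I_n} :=
  [set x | #|[set i | x \in F i]| == 1].

(* Main.v *)
Require Import Defs.
From mathcomp Require Import all_boot all_fingroup zify.

Set Implicit Arguments.
Unset Strict Implicit.
Unset Printing Implicit Defensive.

(** Write [F_x] for the member with [t F_x = x] and draw an edge from [x] to
    every other element of [F_x]; [F] is shellable iff this digraph is acyclic.
    If so, insert the elements one by one in a topological order: when [x] comes,
    [F_x] minus [x] is already linearly ordered and [x] can be given any rank in
    [F_x].  This yields a bijection [sigma].  To lower the number of values,
    merge a non-maximal value taken only on elements of [S] with the next value:
    such an element lies in no member but its own, and its rank there only
    depends on the smaller values.  Conversely the configuration
    [f (t F) = #|F|] forces [sigma] to be strictly decreasing along the edges. *)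

(** Each value of [g] is replaced by its rank, the number of strictly smaller values; this is less
    than [n] because [x] is not below itself. *)
Lemma injective_nat_ord (n : nat) (g : 'I_n -> nat) :
  injective g ->
  exists2 h : 'I_n -> 'I_n,
    injective h & forall x y, (h x < h y) = (g x < g y).
Proof.
move=> g_inj; pose below x := [set y | g y < g x].
have below_lt x : #|below x| < n.
  rewrite -[X in _ < X]card_ord -cardsT; apply: proper_card.
  by apply/properP; split; [apply/subsetP | exists x; rewrite ?inE ?ltnn].
have lt_below x y : g x < g y -> #|below x| < #|below y|.
  move=> lt_xy; apply: proper_card; apply/properP; split.
    by apply/subsetP=> z; rewrite !inE => /ltn_trans; apply.
  by exists x; rewrite ?inE ?ltnn.
exists (fun x => Ordinal (below_lt x)) => [x y /(congr1 val) /= eq_xy|x y /=].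
  apply: g_inj; case: (ltngtP (g x) (g y)) => // /lt_below.
    by rewrite eq_xy ltnn.
  by rewrite eq_xy ltnn.
case: (ltngtP (g x) (g y)) => [/lt_below //|/lt_below/ltnW|/g_inj ->].
  by rewrite leqNgt => /negbTE.
by rewrite ltnn.
Qed.

(** Discrete intermediate values: by injectivity, raising the threshold by one admits at most one
    more element, so no count up to [#|A|] is skipped. *)
Lemma threshold_of_count (T : finType) (A : {set T}) (g : T -> nat) (c : nat) :
  {in A &, injective g} -> c <= #|A| ->
  exists v, #|[set y in A | g y < v]| = c.
Proof.
move=> g_inj le_cA; pose count v := #|[set y in A | g y < v]|.
have ex_v : exists v, c <= count v.
  exists (\max_(y in A) g y).+1; apply: leq_trans le_cA _.
  apply: subset_leq_card; apply/subsetP=> y yA.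
  by rewrite inE yA ltnS /=; apply: leq_bigmax_cond.
case: (ex_minnP ex_v) => v le_cv min_v; exists v; apply/eqP.
rewrite eqn_leq le_cv andbT; case: v le_cv min_v => [|v] _ min_v.
  by rewrite (_ : [set _ in _ | _] = set0) ?cards0 //;
    apply/setP=> y; rewrite !inE andbF.
have lt_vc : count v < c by rewrite ltnNge; apply/negP=> /min_v; rewrite ltnn.
have le1 : #|[set y in A | g y == v]| <= 1.
  apply/card_le1_eqP=> x y; rewrite !inE => /andP[xA /eqP gx] /andP[yA /eqP gy].
  by apply: g_inj; rewrite // gx gy.
have le_sum : count v.+1 <= count v + #|[set y in A | g y == v]|.
  apply: leq_trans (leq_card_setU _ _); apply: subset_leq_card.
  apply/subsetP=> y; rewrite !inE ltnS leq_eqVlt.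
  by case: (y \in A) => //=; rewrite orbC.
rewrite -/(count _); lia.
Qed.

Lemma imset_avoids_nonmax (T : finType) (m : nat) (A : {set T})
    (g : T -> 'I_m.+1) :
  #|A| < m -> exists2 v, v != ord_max & v \notin g @: A.
Proof.
move=> lt_Am; have : 0 < #|~: (ord_max |: g @: A)|.
  rewrite cardsCs setCK card_ord subn_gt0 cardsU1 ltnS.
  by apply: leq_trans lt_Am; apply: leq_add (leq_b1 _) (leq_imset_card _ _).
by case/card_gt0P=> v; rewrite !inE negb_or => /andP[]; exists v.
Qed.

Section Family.

Variables (n : nat) (F : 'I_n -> {set 'I_n}) (t : 'I_n -> 'I_n).
Hypothesis t_trans : family_transversal F t.

Let t_inj : injective t := t_trans.1.

Lemma transversal_onto x : exists i, x = t i.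
Proof. by have /codomP[i ->] := (injF_onto t_inj x); exists i. Qed.

(** The first [k] members contain their [k] distinct representatives, so their union has size [k]
    iff it consists of these alone. Here [r i] is the position of [i] in the shelling, hence the
    inverse permutations. *)
Lemma shellable_acyclic :
  shellable F <->
  exists r : {perm 'I_n}, forall i j, t j \in F i -> j != i -> r j < r i.
Proof.
have card_t (s : {perm 'I_n}) k : k <= n ->
    #|[set t (s i) | i : 'I_n & i < k]| = k.
  move=> le_kn; rewrite card_imset; last by move=> i j /t_inj /perm_inj.
  rewrite -sum1dep_card -[RHS]card_ord -sum1_card.
  by rewrite (big_ord_widen _ (fun=> 1) le_kn).
split=> [[s s_shell]|[r r_acyc]].
  exists (s^-1)%g => i j tjFi neq_ji.
  have le_in := ltn_ord (s^-1 i)%g.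
  have eqU : [set t (s l) | l : 'I_n & l < (s^-1 i)%g.+1]
             = \bigcup_(l < n | l < (s^-1 i)%g.+1) F (s l).
    apply/eqP; rewrite eqEcard s_shell ?card_t // leqnn andbT.
    apply/subsetP=> _ /imsetP[l lt_l ->]; apply/bigcupP; exists l.
      by rewrite inE in lt_l.
    exact: t_trans.2.
  have : t j \in \bigcup_(l < n | l < (s^-1 i)%g.+1) F (s l).
    by apply/bigcupP; exists (s^-1 i)%g; rewrite ?permKV.
  rewrite -eqU => /imsetP[l]; rewrite inE ltnS leq_eqVlt => le_l /t_inj eq_j.
  move: le_l; rewrite eq_j permK => /orP[/eqP/val_inj eq_l|//].
  by rewrite eq_j eq_l permKV eqxx in neq_ji.
exists (r^-1)%g => k /andP[_ le_kn]; rewrite -[RHS](card_t (r^-1)%g) //.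
apply: eq_card; apply/subset_eqP/andP; split; apply/subsetP=> x.
  case/bigcupP=> l lt_lk; have [j ->] := transversal_onto x => tjF.
  apply/imsetP; exists (r j); rewrite ?permK // inE.
  have [eq_j|neq_j] := eqVneq j ((r^-1)%g l); first by rewrite eq_j permKV.
  by apply: ltn_trans lt_lk; have := r_acyc _ _ tjF neq_j; rewrite permKV.
case/imsetP=> l; rewrite inE => lt_lk ->; apply/bigcupP; exists l => //.
exact: t_trans.2.
Qed.

Lemma satisfies_inj (f : 'I_n -> nat) (r : {perm 'I_n}) :
  (forall i j, t j \in F i -> j != i -> r j < r i) -> configuration F t f ->
  exists2 sigma : 'I_n -> 'I_n, injective sigma & satisfies F t f sigma.
Proof.
move=> r_acyc [f_gt0 f_le].
have insertion k : k <= n -> exists g : 'I_n -> nat,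
    {in [pred x | [exists i, (x == t i) && (r i < k)]] &, injective g} /\
    forall i, r i < k -> #|[set y in F i | g y < g (t i)]|.+1 = f (t i).
  elim: k => [_|k IHk lt_kn].
    exists (fun=> 0); split=> // x y /=; rewrite inE => /existsP[i].
    by rewrite andbF.
  have [g [g_inj g_rank]] := IHk (ltnW lt_kn).
  pose i0 := (r^-1)%g (Ordinal lt_kn).
  have r_i0 : r i0 = k :> nat by rewrite /i0 permKV.
  have r_eqk i : r i = k :> nat -> i = i0.
    by move=> r_i; apply: (@perm_inj _ r); apply: val_inj; rewrite /= r_i r_i0.
  (* For [i = i0]: all elements of [F i0] except [t i0] are already placed, so [g] is injective on
     them. *)
  have prev i j : r i < k.+1 -> t j \in F i :\ t i0 -> r j < k.
    rewrite !inE => lt_i /andP[neq_j tjF].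
    have [eq_ij|neq_ij] := eqVneq j i; last first.
      by have := r_acyc _ _ tjF neq_ij; lia.
    rewrite -eq_ij ltnS leq_eqVlt in lt_i; case/orP: lt_i => // /eqP/r_eqk eq_j.
    by rewrite eq_j eqxx in neq_j.
  have card_i0 : #|F i0 :\ t i0|.+1 = #|F i0|.
    by rewrite [RHS](cardsD1 (t i0)) t_trans.2.
  have [v count_v] : exists v,
      #|[set y in F i0 :\ t i0 | g y < v]| = (f (t i0)).-1.
    apply: threshold_of_count; last by have := f_le i0; lia.
    move=> x y; have [i ->] := transversal_onto x.
    have [j ->] := transversal_onto y => /prev-lt_i /prev-lt_j.
    apply: g_inj; rewrite inE; apply/existsP.
      by exists i; rewrite eqxx lt_i ?r_i0.
    by exists j; rewrite eqxx lt_j ?r_i0.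
  (* Old values become odd and the new one is even, so they never collide; [(g y).*2.+1 < v.*2] iff
     [g y < v], which gives [t i0] its prescribed rank. *)
  exists (fun y => if y == t i0 then v.*2 else (g y).*2.+1); split.
    move=> x y; rewrite !inE => /existsP[i /andP[/eqP-> lt_i]].
    case/existsP=> j /andP[/eqP-> lt_j].
    rewrite !(inj_eq t_inj).
    have [->|neq_i] := eqVneq i i0; have [->|neq_j] := eqVneq j i0 => //; try lia.
    move=> eq_g; apply: g_inj; last by lia.
      rewrite inE; apply/existsP; exists i; rewrite eqxx /=.
      move: lt_i; rewrite ltnS leq_eqVlt => /orP[/eqP/r_eqk/eqP|//].
      by rewrite (negPf neq_i).
    rewrite inE; apply/existsP; exists j; rewrite eqxx /=.
    move: lt_j; rewrite ltnS leq_eqVlt => /orP[/eqP/r_eqk/eqP|//].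
    by rewrite (negPf neq_j).
  move=> i; rewrite ltnS leq_eqVlt => /orP[/eqP/r_eqk ->|lt_i].
    rewrite eqxx -[RHS](prednK (f_gt0 _)) -count_v; congr _.+1.
    apply: eq_card=> y; rewrite !inE; case: eqP => [->|_] /=.
      by rewrite ltnn andbF.
    by congr (_ && _); lia.
  (* A member placed earlier cannot contain [t i0], by acyclicity, so its ranks are unchanged. *)
  have neq_i : i != i0 by apply/eqP=> eq_i; rewrite eq_i r_i0 ltnn in lt_i.
  rewrite (inj_eq t_inj) (negPf neq_i) -g_rank //; congr _.+1.
  apply: eq_card=> y; rewrite !inE; case yF : (y \in F i) => //=.
  case: eqP yF => [-> t_i0F|_ _]; last by lia.
  by have := r_acyc _ _ t_i0F; rewrite eq_sym neq_i r_i0 => /(_ isT); lia.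
have [g [g_inj g_rank]] := insertion n (leqnn n).
have {}g_inj : injective g.
  move=> x y; have [i ->] := transversal_onto x.
  have [j ->] := transversal_onto y.
  apply: g_inj; rewrite inE; apply/existsP; first by exists i; rewrite eqxx /=.
  by exists j; rewrite eqxx /=.
have [sigma sigma_inj lt_sigma] := injective_nat_ord g_inj.
exists sigma => // i; split; first by apply: imset_f; apply: t_trans.2.
rewrite -g_rank ?ltn_ord // -[in RHS](card_imset _ sigma_inj); congr _.+1.
apply: eq_card=> y; rewrite !inE; apply/andP/imsetP.
  by case=> /imsetP[x xF ->] lt_x; exists x; rewrite // inE xF -lt_sigma.
by case=> x; rewrite inE -lt_sigma => /andP[xF lt_x] ->; rewrite imset_f.
Qed.

Lemma in_exactly_one_own x i :
  x \in in_exactly_one F -> x \in F i -> x = t i.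
Proof.
rewrite inE => /cards1P[l eq_l] xFi; have [j eq_x] := transversal_onto x.
have : i \in [set l] by rewrite -eq_l inE.
have : j \in [set l] by rewrite -eq_l inE eq_x t_trans.2.
by rewrite eq_x !inE => /eqP-> /eqP->.
Qed.

Lemma satisfies_merge (f : 'I_n -> nat) (m : nat) (sigma : 'I_n -> 'I_m.+1) :
  n - #|in_exactly_one F| < m -> surjective sigma -> satisfies F t f sigma ->
  exists sigma' : 'I_n -> 'I_m, surjective sigma' /\ satisfies F t f sigma'.
Proof.
move=> lt_m sigma_onto sigma_sat; set S := in_exactly_one F.
have card_NS : #|~: S| < m by rewrite cardsCs setCK card_ord.
have [v neq_v v_pure] := imset_avoids_nonmax sigma card_NS.
have lt_vm : v < m by move: neq_v (ltn_ord v); rewrite -val_eqE /=; lia.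
have own i : v \in sigma @: F i -> sigma (t i) = v.
  case/imsetP=> x xF eq_v; rewrite -(in_exactly_one_own _ xF) //.
  by apply: contraR v_pure => xNS; rewrite eq_v imset_f // inE.
(* [unbump v] lowers the values above [v] by one, thus identifying [v] with its successor; the bound
   needs [v] non-maximal. *)
have merge_lt (w : 'I_m.+1) : unbump v w < m.
  by have := ltn_ord w; rewrite /unbump; lia.
pose mu w := Ordinal (merge_lt w).
exists (mu \o sigma); split.
  move=> w; have [x eq_x] := sigma_onto (lift v w); exists x.
  by apply: val_inj; rewrite /= eq_x /= bumpK.
move=> i; have [t_in rank_t] := sigma_sat i; split.
  by apply: imset_f; apply: t_trans.2.
rewrite -rank_t; congr _.+1.
set A := sigma @: F i; set a := sigma (t i).
(* Only [w = v] and [a = v + 1] could break this, but [v] in [A] forces [a = v]. For the same reason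
   no value of [A] below [a] is [v], and [mu] is injective away from [v]. *)
have lt_mu w : w \in A -> (mu w < mu a) = (w < a).
  move=> wA; have [eq_w|neq_w] := eqVneq w v.
    by rewrite /a own -?eq_w // !ltnn.
  by move: neq_w; rewrite -val_eqE /= /unbump; lia.
rewrite -(card_in_imset (f := mu) (D := mem [set y in A | y < a])).
  apply: eq_card=> y; rewrite !inE; apply/andP/imsetP.
    case=> /imsetP[x xF ->] /= lt_x; exists (sigma x) => //.
    by rewrite inE imset_f // -lt_mu // imset_f.
  case=> w; rewrite inE => /andP[wA lt_wa] ->; rewrite lt_mu //; split=> //.
  by case/imsetP: wA => x xF ->; apply/imsetP; exists x.
have neq_v_below w : w \in A -> w < a -> w != v.
  move=> wA; apply: contraTneq => eq_w.
  by rewrite /a own -?eq_w // ltnn.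
move=> w w'; rewrite !inE => /andP[wA lt_wa] /andP[w'A lt_wa'] /(congr1 val) /=.
move: (neq_v_below w wA lt_wa) (neq_v_below w' w'A lt_wa').
by rewrite -!val_eqE /= /unbump => ? ? ?; apply: val_inj => /=; lia.
Qed.

(** Top rank requires [#|F i| - 1] values below [sigma (t i)]. Only the [#|F i| - 1] other elements
    can supply them, so each of these must lie below. *)
Lemma maximal_rank_lt (m : nat) (f : 'I_n -> nat) (sigma : 'I_n -> 'I_m) i x :
  satisfies F t f sigma -> f (t i) = #|F i| -> x \in F i -> x != t i ->
  sigma x < sigma (t i).
Proof.
move=> sigma_sat f_max xF neq_x; have [_] := sigma_sat i.
rewrite f_max (cardsD1 (t i)) t_trans.2 add1n => -[eq_card].
have sub : [set y in sigma @: F i | y < sigma (t i)] \subset sigma @: (F i :\ t i).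
  apply/subsetP=> y; rewrite inE => /andP[/imsetP[z zF ->] lt_z].
  apply: imset_f; rewrite !inE zF andbT.
  by apply: contraTneq lt_z => ->; rewrite ltnn.
have eq_im : [set y in sigma @: F i | y < sigma (t i)] = sigma @: (F i :\ t i).
  by apply/eqP; rewrite eqEcard sub eq_card leq_imset_card.
have : sigma x \in sigma @: (F i :\ t i) by rewrite imset_f // !inE neq_x.
by rewrite -eq_im inE => /andP[].
Qed.

End Family.

Theorem theorem3p23 (n : nat) (F : 'I_n -> {set 'I_n}) (t : 'I_n -> 'I_n)
    (m : nat) (n_gt0 : 0 < n) (marriageF : marriage_condition F)
    (transF : family_transversal F t)
    (m_ge : minn n (n - #|in_exactly_one F| + 1) <= m) (m_le : m <= n) :
  shellable F <->
  (forall f : 'I_n -> nat, configuration F t f ->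
     exists sigma : 'I_n -> 'I_m, surjective sigma /\ satisfies F t f sigma).
Proof.
rewrite (shellable_acyclic transF); split=> [[r r_acyc] f f_conf|all_conf].
  have [d eq_d] : exists d, n = d + m by exists (n - m); lia.
  (* Start from a bijection at [p = n] and merge one value per step; when [p < n], the lower bound
     on [p] becomes [n - #|S| < p], as merging requires. *)
  elim: d m m_ge m_le eq_d => [|d IHd] p p_ge p_le eq_d.
    have {p_ge p_le} eq_d : p = n by lia.
    subst p; have [sigma sigma_inj sigma_sat] := satisfies_inj transF r_acyc f_conf.
    exists sigma; split=> // y.
    by have /codomP[x ->] := injF_onto sigma_inj y; exists x.
  have [||| sigma [sigma_onto sigma_sat]] := IHd p.+1; try lia.
  by apply: (satisfies_merge transF _ sigma_onto sigma_sat); lia.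
have [t_inj t_in] := transF.
have [t' tK _] := injF_bij t_inj.
pose f x := #|F (t' x)|.
have f_t i : f (t i) = #|F i| by rewrite /f tK.
have f_conf : configuration F t f.
  split=> [x|i]; last by rewrite f_t.
  by have [i ->] := transversal_onto transF x; rewrite f_t;
    apply/card_gt0P; exists (t i).
have [sigma [_ sigma_sat]] := all_conf f f_conf.
(* Ties of [sigma \o t] are broken by the index. *)
pose g (i : 'I_n) := sigma (t i) * n + i.
have g_inj : injective g.
  move=> i j /(congr1 (modn^~ n)); rewrite !modnMDl !modn_small //.
  exact: val_inj.
have [h h_inj lt_h] := injective_nat_ord g_inj.
exists (perm h_inj) => i j tjF neq_ji; rewrite !permE lt_h /g.
have := maximal_rank_lt transF sigma_sat (f_t i) tjF.
rewrite (inj_eq t_inj) => /(_ neq_ji) lt_ji.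
have := ltn_ord j; nia.
Qed.
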